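(* In the setting and under the regularity assumption of the context, let $(\bar x_T,\bar{\mathbb Q}_T)$ be the output of the Distributional Best-Response algorithm and let $\mathcal S_i$, $i\in[N]$, be the finite sets of historical atoms, as described in the context. Consider the restricted dual program $$\begin{array}{cl}\max&\displaystyle-\frac1N\sum_{i=1}^N\sum_{z\in\mathcal S_i}\sum_{k=1}^K\alpha_{izk}\,\ell_k^{*1}(y_{izk},z)-\nu\,\sigma_{\mathcal X}(\theta)\\ \text{s.t.}&\alpha_{izk}\in\mathbb R_+,\ y_{izk}\in\mathbb R^n,\ \theta\in\mathbb R^n,\ \nu\in\mathbb R_+,\\ &\displaystyle\frac1N\sum_{i=1}^N\sum_{z\in\mathcal S_i}\sum_{k=1}^K\alpha_{izk}y_{izk}+\nu\theta=0,\quad\frac1N\sum_{i=1}^N\sum_{z\in\mathcal S_i}\sum_{k=1}^K\alpha_{izk}c(z,\hat z_i)\le\rho,\\ &\displaystyle\sum_{z\in\mathcal S_i}\sum_{k=1}^K\alpha_{izk}=1\quad\forall i\in[N].\end{array}$$ Given an optimal solution $\{\alpha^\star_{izk},y^\star_{izk},\theta^\star,\nu^\star\}$ to this program, the discrete distribution $$\tilde{\mathbb Q}:=\frac1N\sum_{i=1}^N\sum_{z\in\mathcal S_i}\sum_{k=1}^K\alpha^\star_{izk}\delta_z$$ belongs to $\mathcal P$, and $(\bar x_T,\tilde{\mathbb Q})$ does not increase the duality gap of $(\bar x_T,\bar{\mathbb Q}_T)$, i.e. $\mathrm{Gap}(\bar x_T,\tilde{\mathbb Q})\le\mathrm{Gap}(\bar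 x_T,\bar{\mathbb Q}_T)$. Furthermore, there exists an optimal solution of the restricted dual program in which at most $N+n+1$ of the weights $\{\alpha^\star_{izk}\}$ are nonzero, so that the support size of $\tilde{\mathbb Q}$ is at most $N+n+1$.
   Context: Notation: $[n]=\{1,\dots,n\}$; $\mathcal P(\mathcal Z)$ is the set of Borel probability measures on $\mathcal Z$; $f(x,\mathbb Q)=\mathbb E_{z\sim\mathbb Q}[\ell(x,z)]$; $\mathrm{Gap}(x',\mathbb Q')=\max_{\mathbb Q\in\mathcal P}f(x',\mathbb Q)-\min_{x\in\mathcal X}f(x,\mathbb Q')$. $\ell_k^{*1}(w,z)=\sup_{x\in\mathbb R^n}\{w^\top x-\ell_k(x,z)\}$; $\sigma_{\mathcal X}(\theta)=\sup_{x\in\mathcal X}\theta^\top x$. Products with a zero coefficient are understood through the perspective convention, so terms with $\alpha_{izk}=0$ or $\nu=0$ equal $0$. Setting. $\mathcal X\subseteq\mathbb R^n$, $\mathcal Z\subseteq\mathbb R^m$. A transportation cost $c:\mathcal Z\times\mathcal Z\to\mathbb R_+$ is lower semicontinuous, satisfies $c(z,z)=0$ for all $z$, and $c(\cdot,\hat z)$ is convex for every fixed $\hat z\in\mathcal Z$. The optimal transport discrepancy is $\mathrm{OT}_c(\mathbb P,\mathbb Q)=\min_{\gamma}\mathbb E_{(z,\hat z)\sim\gamma}[c(z,\hat z)]$ over couplings $\gamma$ of $\mathbb P$ and $\mathbb Q$. Given $\hat z_1,\dots,\hat z_N\in\mathcal Z$, let $\hat{\mathbb P}=\frac1N\sum_{i=1}^N\delta_{\hat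 z_i}$; given $\rho>0$, let $\mathcal P=\{\mathbb P\in\mathcal P(\mathcal Z):\mathrm{OT}_c(\mathbb P,\hat{\mathbb P})\le\rho\}$. Regularity assumption. (i) $\mathcal X$ is nonempty and convex; there exist $\mathbb Q_0\in\mathcal P$ and $x_0\in\mathcal X$ such that $x\mapsto\mathbb E_{z\sim\mathbb Q_0}[\ell(x,z)]$ is inf-compact on $\mathcal X$ (all sublevel sets are compact) and $\mathbb E_{z\sim\mathbb Q_0}[\ell(x_0,z)]>-\infty$; $\mathcal Z$ is nonempty, closed and convex. (ii) $\ell(x,z)=\max_{k\in[K]}\ell_k(x,z)$ with $K\ge2$, where each $\ell_k:\mathbb R^n\times\mathbb R^m\to\mathbb R$ is real-valued, convex in its first and concave in its second argument. (iii) There exist a norm $\|\cdot\|$ on $\mathbb R^m$ and $p\ge1$ with $c(z,\hat z)\ge\|z-\hat z\|^p$ for all $z,\hat z\in\mathcal Z$; moreover, if $p=1$, then for every $x\in\mathcal X$ there exist $g>0$, $\hat z_0\in\mathcal Z$ and $r\in[0,1)$ such that $\ell(x,z)\le g[1+\|z-\hat z_0\|^r]$ for all $z\in\mathcal Z$. Distributional Best-Response algorithm. Starting from $x_1\in\mathcal X$, for $t=1,\dots,T$: an oracle returns an (approximate) maximizer $\mathbb Q_t\in\mathcal P$ of $f(x_t,\cdot)$ over $\mathcal P$; then $x_{t+1}\in\mathcal X$ is produced from $(x_t,f(\cdot,\mathbb Q_t))$ by an online algorithm. The output is $\bar x_T=\frac1T\sum_tx_t$, $\bar{\mathbb Q}_T=\frac1T\sum_t\mathbb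 Q_t$. Each $\mathbb Q_t$ has the form $\mathbb Q_t=\frac1N\sum_{i=1}^N\mathbb Q_{t,i}$, where $\mathbb Q_{t,i}$ is a finitely supported probability measure on $\mathcal Z$ (the redistribution of the mass of sample $\hat z_i$) and $\frac1N\sum_i\mathbb E_{z\sim\mathbb Q_{t,i}}[c(z,\hat z_i)]\le\rho$. The set of historical atoms of sample $i$ is $\mathcal S_i=\bigcup_{t=1}^T\mathrm{supp}(\mathbb Q_{t,i})$. *)

(* Defs.v *)
From HB Require Import structures.
From mathcomp Require Export all_boot all_order all_algebra.
From mathcomp Require Export finmap.
From mathcomp Require Export all_classical all_reals all_analysis.

Set Implicit Arguments.
Unset Strict Implicit.
Unset Printing Implicit Defensive.

Import Order.TTheory GRing.Theory Num.Theory.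
Import numFieldNormedType.Exports.

Local Open Scope classical_set_scope.
Local Open Scope ring_scope.

Definition rV_open (R : realType) (m : nat) : set (set 'rV[R]_m) := open.

HB.instance Definition _ (R : realType) (m : nat) :=
  @isMeasurable.Build (sigma_display (@rV_open R m)) 'rV[R]_m
    <<s @rV_open R m >> (@sigma_algebra0 _ setT _)
    (@sigma_algebraC _ _) (@sigma_algebra_bigcup _ setT _).

Section measures.
Context {R : realType} {m : nat}.
Local Notation E := 'rV[R]_m.
Local Notation measureE := {measure set E -> \bar R}.

Definition addm (mu nu : measureE) : measureE := measure_add mu nu.
Definition scalem (a : {nonneg R}) (mu : measureE) : measureE := mscale a mu.
Definition summ (I : Type) (s : seq I) (mu : I -> measureE) : measureE :=
  \big[addm/(mzero : measureE)]_(i <- s) mu i.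
Definition meanm (N : nat) (mu : 'I_N -> measureE) : measureE :=
  scalem (N%:R^-1)%:nng (summ (index_enum 'I_N) mu).

Definition supp (Q : measureE) : set E :=
  [set z | forall U : set E, open U -> U z -> (0 < Q U)%E].

(* Borel probability measures on a closed subset Z of R^m, seen as measures on
   R^m carried by Z *)
Definition prob_on (Z : set E) (Q : measureE) : Prop :=
  Q setT = 1%E /\ Q Z = 1%E.

Definition finite_prob_on (Z : set E) (Q : measureE) : Prop :=
  prob_on Z Q /\ exists F : set E, [/\ finite_set F, F `<=` Z & Q (~` F) = 0%E].

Definition coupling (P Q : measureE)
    (gamma : {measure set (E * E) -> \bar R}) : Prop :=
  forall A : set E, measurable A ->
    gamma (A `*` setT) = P A /\ gamma (setT `*` A) = Q A.

Definition is_norm (nrm : E -> R) : Prop :=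
  [/\ forall u v, nrm (u + v) <= nrm u + nrm v,
      forall (a : R) u, nrm (a *: u) = `|a| * nrm u
    & forall u, nrm u = 0 -> u = 0].

(* c is only meaningful on Z x Z; its values elsewhere are irrelevant. *)
Definition transport_cost (Z : set E) (c : E -> E -> R) : Prop :=
  [/\ forall z z', Z z -> Z z' -> 0 <= c z z',
      lower_semicontinuous
        (fun zz : subspace (Z `*` Z) => (c zz.1 zz.2)%:E),
      forall z, Z z -> c z z = 0
    & forall z', Z z' -> convex_function Z (fun z : E => c z z')].

Definition OT (Z : set E) (c : E -> E -> R) (P Q : measureE) : \bar R :=
  ereal_inf [set (\int[gamma]_(zz in Z `*` Z) (c zz.1 zz.2)%:E)%E
            | gamma in coupling P Q].

Definition empirical (N : nat) (zhat : 'I_N -> E) : measureE :=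
  meanm (fun i => \d_(zhat i) : measureE).

Definition ambiguity (N : nat) (Z : set E) (c : E -> E -> R)
    (zhat : 'I_N -> E) (rho : R) : set measureE :=
  [set P | prob_on Z P /\ (OT Z c P (empirical zhat) <= rho%:E)%E].

End measures.

Section game.
Context {R : realType} {n m N K : nat}.
Variables (X : set 'rV[R]_n) (Z : set 'rV[R]_m).
Variables (c : 'rV[R]_m -> 'rV[R]_m -> R) (zhat : 'I_N -> 'rV[R]_m) (rho : R).
Variable l : 'I_K -> 'rV[R]_n -> 'rV[R]_m -> R.
Local Notation measureE := {measure set 'rV[R]_m -> \bar R}.

Definition dot (u v : 'rV[R]_n) : R := \sum_(j < n) u 0 j * v 0 j.

(* Real-valued for K > 0; written in \bar R so that the maximum has a unit. *)
Definition loss (x : 'rV[R]_n) (z : 'rV[R]_m) : \bar R :=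
  \big[maxe/-oo%E]_(k < K) (l k x z)%:E.

(* May take the value -oo, but never +oo on the ambiguity set. *)
Definition risk (x : 'rV[R]_n) (Q : measureE) : \bar R :=
  (\int[Q]_z loss x z)%E.

Definition gap (x : 'rV[R]_n) (Q : measureE) : \bar R :=
  (ereal_sup [set risk x Q' | Q' in ambiguity Z c zhat rho]
   - ereal_inf [set risk x' Q | x' in X])%E.

Definition inf_compact_on (h : 'rV[R]_n -> \bar R) : Prop :=
  forall a : R, compact (X `&` [set x | (h x <= a%:E)%E]).

Definition regular_sets : Prop :=
  [/\ X !=set0, convex_set X,
      exists Q0 x0, [/\ ambiguity Z c zhat rho Q0, X x0,
        inf_compact_on (fun x => risk x Q0) & (-oo < risk x0 Q0)%E]
    & [/\ Z !=set0, closed Z & convex_set Z]].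

Definition regular_loss : Prop :=
  [/\ (2 <= K)%N,
      forall k z, convex_function setT (fun x : 'rV[R]_n => l k x z)
    & forall k x, convex_function setT (fun z : 'rV[R]_m => - l k x z)].

Definition regular_growth : Prop :=
  exists (nrm : 'rV[R]_m -> R) (p : R),
  [/\ is_norm nrm, 1 <= p,
      forall z z', Z z -> Z z' -> nrm (z - z') `^ p <= c z z'
    & p = 1 -> forall x, X x -> exists (g : R) (z0 : 'rV[R]_m) (r : R),
        [/\ 0 < g, Z z0, 0 <= r < 1
          & forall z, Z z ->
              (loss x z <= (g * (1 + nrm (z - z0) `^ r))%:E)%E]].

Definition regularity : Prop :=
  [/\ regular_sets, regular_loss & regular_growth].

(* Rounds are numbered from 0.  eps t is the accuracy of the oracle at round t;
   alg is an arbitrary (possibly time-dependent) update rule. *)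
Record dbr_run (T : nat)
    (alg : nat -> 'rV[R]_n -> ('rV[R]_n -> \bar R) -> 'rV[R]_n)
    (eps : 'I_T -> R) (x : nat -> 'rV[R]_n) (Q : 'I_T -> 'I_N -> measureE) :
    Prop := DbrRun {
  dbr_start : X (x 0%N);
  dbr_atomic : forall t i, finite_prob_on Z (Q t i);
  dbr_cost : forall t,
    (N%:R^-1%:E * \sum_(i < N) \int[Q t i]_(z in Z) (c z (zhat i))%:E
     <= rho%:E)%E;
  dbr_ambiguity : forall t, ambiguity Z c zhat rho (meanm (Q t));
  dbr_eps_ge0 : forall t, 0 <= eps t;
  dbr_oracle : forall t : 'I_T,
    (ereal_sup [set risk (x t) Q' | Q' in ambiguity Z c zhat rho]
     <= risk (x t) (meanm (Q t)) + (eps t)%:E)%E;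
  dbr_update : forall t : 'I_T,
    x t.+1 = alg t (x t) (fun x' => risk x' (meanm (Q t)));
  dbr_feasible : forall t : 'I_T, X (x t.+1)
}.

Definition avg_decision (T : nat) (x : nat -> 'rV[R]_n) : 'rV[R]_n :=
  T%:R^-1 *: \sum_(t < T) x t.

Definition avg_measure (T : nat) (Q : 'I_T -> 'I_N -> measureE) : measureE :=
  meanm (fun t => meanm (Q t)).

(* fset_set is faithful here: the union is finite along a dbr_run. *)
Definition atoms (T : nat) (Q : 'I_T -> 'I_N -> measureE) (i : 'I_N) :
    {fset 'rV[R]_m} :=
  fset_set (\bigcup_(t in [set: 'I_T]) supp (Q t i)).

Definition conj1 (k : 'I_K) (w : 'rV[R]_n) (z : 'rV[R]_m) : \bar R :=
  ereal_sup [set (dot w x - l k x z)%:E | x in [set: 'rV[R]_n]].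

Definition support_fun (theta : 'rV[R]_n) : \bar R :=
  ereal_sup [set (dot theta x)%:E | x in X].

(* The components indexed by i, z, k only matter for z in the atom set of i. *)
Record dual_var := DualVar {
  dv_alpha : 'I_N -> 'rV[R]_m -> 'I_K -> {nonneg R};
  dv_y : 'I_N -> 'rV[R]_m -> 'I_K -> 'rV[R]_n;
  dv_theta : 'rV[R]_n;
  dv_nu : {nonneg R}
}.

Variable S : 'I_N -> {fset 'rV[R]_m}.

Definition dual_feasible (d : dual_var) : Prop :=
  [/\ N%:R^-1 *: (\sum_(i < N) \sum_(z <- S i) \sum_(k < K)
         (dv_alpha d i z k)%:num *: dv_y d i z k)
       + (dv_nu d)%:num *: dv_theta d = 0,
      N%:R^-1 * (\sum_(i < N) \sum_(z <- S i) \sum_(k < K)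
         (dv_alpha d i z k)%:num * c z (zhat i)) <= rho
    & forall i, \sum_(z <- S i) \sum_(k < K) (dv_alpha d i z k)%:num = 1].

(* conj1 and support_fun may be +oo but, X being nonempty, never -oo;
   0 * +oo = 0 in \bar R is the perspective convention. *)
Definition dual_objective (d : dual_var) : \bar R :=
  (- (N%:R^-1%:E * \sum_(i < N) \sum_(z <- S i) \sum_(k < K)
        (dv_alpha d i z k)%:num%:E * conj1 k (dv_y d i z k) z)
   - (dv_nu d)%:num%:E * support_fun (dv_theta d))%E.

Definition dual_optimal (d : dual_var) : Prop :=
  dual_feasible d /\
  forall d', dual_feasible d' -> (dual_objective d' <= dual_objective d)%E.

Definition dual_measure (d : dual_var) : measureE :=
  meanm (fun i => summ (S i) (fun z =>
    summ (index_enum 'I_K) (fun k =>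
      scalem (dv_alpha d i z k) (\d_z : measureE)))).

Definition nb_nonzero_weights (d : dual_var) : nat :=
  (\sum_(i < N) \sum_(z <- S i) \sum_(k < K)
     ((dv_alpha d i z k)%:num != 0%R))%N.

End game.

(* Main.v *)
Require Import Defs.
From HB Require Import structures.
From mathcomp Require Import ring lra measurable_realfun.

Import Order.TTheory GRing.Theory Num.Theory.
Import numFieldNormedType.Exports.
Local Open Scope classical_set_scope.
Local Open Scope ring_scope.

(** The restricted dual is the Lagrange dual of minimising, over [x] in [X], the
    largest value of [1/N sum_j a_j f_j(x)], where [j] runs over the triples
    (sample, historical atom, piece) and the weights [a] have unit mass on every
    sample and respect the transport budget.  Writing the inner linear program
    by its own dual turns this into one convex minimisation problem.  Its value
    function, under perturbation of every [f_j] both by a shift of the argument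
    and by an additive constant, is finite everywhere because the [f_j] are
    real-valued; hence it has a subgradient at 0 without any constraint
    qualification, and the components of that subgradient are an optimal
    solution of the restricted dual.  This gives strong duality and attainment at once.

    The averaged history of the algorithm is a feasible choice of masses, so the
    dual value dominates the infimum of the risk under the averaged measure, and
    weak duality bounds the risk under the new measure from below by that value.
    With the slopes [y] frozen, the weights solve a linear program with
    [N + n + 1] constraints, whence the sparse solution.

    All measures that have to be integrated are finitely supported, and the
    integral against such a measure is a finite sum for every function, measurable
    or not. *)

(** * Convex analysis *)

(* [G] plays the role of the epigraph of a convex function that is finite
   everywhere; the functional is extended one coordinate at a time, as in the
   Hahn-Banach theorem. *)
Lemma convex_minorant (R : realType) (I : finType) (G : (I -> R) -> R -> Prop) :
  (forall p r p' r' t, G p r -> G p' r' -> 0 < t < 1 ->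
     G (fun i => t * p i + (1 - t) * p' i) (t * r + (1 - t) * r')) ->
  (forall p, exists r, G p r) ->
  (forall r, G (fun=> 0) r -> 0 <= r) ->
  exists h : I -> R, forall p r, G p r -> \sum_i h i * p i <= r.
Proof.
move=> Gconv Gtot G0.
suff: forall s : seq I, exists h : I -> R, forall p r,
    (forall i, i \notin s -> p i = 0) -> G p r -> \sum_i h i * p i <= r.
  by move=> /(_ (enum I))[h hh]; exists h => p r; apply: hh => i; rewrite mem_enum.
elim=> [|a s [h hh]].
  exists (fun=> 0) => p r p0 Gpr.
  rewrite big1 => [|i _]; last by rewrite mul0r.
  by apply: G0; rewrite (_ : (fun=> 0) = p) //; apply/funext => i; rewrite p0.
pose phi (p : I -> R) := \sum_(i | i != a) h i * p i.
have phiE h' p : (forall i, i != a -> h' i = h i) ->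
    \sum_i h' i * p i = h' a * p a + phi p.
  move=> h'h; rewrite (bigD1 a)//=; congr (_ + _).
  by apply: eq_bigr => i /h'h ->.
pose adm (p : I -> R) := forall i, i \notin a :: s -> p i = 0.
(* Points with [p a > 0] bound the new coefficient from above, those with [p a < 0] from below. The
   convex combination cancelling coordinate [a] falls under the induction hypothesis, which makes
   the two families of bounds compatible. *)
have cross p r p' r' : adm p -> adm p' -> G p r -> G p' r' ->
    0 < p a -> p' a < 0 -> (r' - phi p') / p' a <= (r - phi p) / p a.
  move=> ap ap' Gp Gp' pa p'a.
  set t := - p' a / (p a - p' a).
  have d0 : 0 < p a - p' a by lra.
  have t01 : 0 < t < 1.
    by rewrite /t divr_gt0 ?oppr_gt0//= ltr_pdivrMr// mul1r; lra.
  set q := fun i => t * p i + (1 - t) * p' i.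
  have qa : q a = 0 by rewrite /q /t; field; rewrite gt_eqF.
  have := hh q _ _ (Gconv _ _ _ _ _ Gp Gp' t01).
  rewrite (phiE h)// qa mulr0 add0r.
  have -> : phi q = t * phi p + (1 - t) * phi p'.
    rewrite /phi !mulr_sumr -big_split /=; apply: eq_bigr => i _.
    by rewrite /q; ring.
  have adq i : i \notin s -> q i = 0.
    have [->//|ia] := eqVneq i a; move=> si.
    by rewrite /q ap ?ap' ?inE ?negb_or ?ia// !mulr0 addr0.
  move=> /(_ adq) le1.
  have : 0 <= (t * (r - phi p) + (1 - t) * (r' - phi p')) * (p a - p' a).
    rewrite mulr_ge0 ?(ltW d0)//; move: le1; rewrite -subr_ge0.
    by congr (0 <= _); ring.
  have -> : (t * (r - phi p) + (1 - t) * (r' - phi p')) * (p a - p' a) =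
     - p' a * (r - phi p) + p a * (r' - phi p').
    by rewrite /t; field; rewrite gt_eqF.
  move=> le2.
  rewrite ler_pdivlMr// mulrAC ler_ndivrMr//; lra.
pose L := [set b | exists p r,
  [/\ adm p, G p r, p a < 0 & b = (r - phi p) / p a]].
have [r1 Gr1] := Gtot (fun i => (i == a)%:R).
have [r2 Gr2] := Gtot (fun i => - (i == a)%:R).
have ad1 : adm (fun i => (i == a)%:R).
  by move=> i; rewrite inE negb_or => /andP[/negbTE->].
have ad2 : adm (fun i => - (i == a)%:R).
  by move=> i; rewrite inE negb_or => /andP[/negbTE->]; rewrite oppr0.
have Lub p r : adm p -> G p r -> 0 < p a -> ubound L ((r - phi p) / p a).
  by move=> ap Gp pa _ [p' [r' [ap' Gp' pa' ->]]]; apply: cross.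
have supL : has_sup L.
  split; last by eexists; apply: (Lub _ _ ad1 Gr1); rewrite eqxx ltr01.
  by eexists; exists (fun i => - (i == a)%:R), r2; split=> //; rewrite eqxx ltrN10.
exists (fun i => if i == a then sup L else h i) => p r ap Gp.
rewrite (phiE (fun i => if i == a then sup L else h i)); last first.
  by move=> i /negbTE ->.
rewrite eqxx; case: (ltrgt0P (p a)) => pa.
- rewrite -lerBrDr -ler_pdivlMr//; apply: ge_sup; first exact: (proj1 supL).
  exact: Lub.
- rewrite -lerBrDr -ler_ndivrMr//; apply: ub_le_sup; first exact: (proj2 supL).
  by exists p, r.
- rewrite pa mulr0 add0r; suff <- : \sum_i h i * p i = phi p.
    apply: hh Gp => i si; have [->//|ia] := eqVneq i a.
    by apply: ap; rewrite inE negb_or ia.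
  by rewrite (phiE h)// pa mulr0 add0r.
Qed.

(* A vanishing combination of more than r of the vectors W j gives a direction
   along which the weights can be moved until one of them vanishes; the vector
   w forces that direction to have a negative entry. *)
Lemma sparse_conic_combination (R : realFieldType) (J : finType) (r : nat)
    (W : J -> 'rV[R]_r) (w : 'rV[R]_r) (b a : J -> R) :
  (forall j, \sum_(k < r) W j 0 k * w 0 k = 1) ->
  (forall j, 0 <= a j) ->
  exists a' : J -> R,
    [/\ forall j, 0 <= a' j, forall j, a j = 0 -> a' j = 0,
        \sum_j a' j *: W j = \sum_j a j *: W j,
        \sum_j a' j * b j <= \sum_j a j * b j
      & (#|[set j | a' j != 0%R]%SET| <= r)%N].
Proof.
move=> Ww; move sE : #|[set j | a j != 0%R]%SET| => s.
elim/ltn_ind: s a sE => s IH a sE a0.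
have [sr|rs] := leqP s r; first by exists a; split=> //; rewrite sE.
pose A := [set j | a j != 0]%SET.
have [del [delA delW [j0 dj0]]] : exists del : J -> R,
    [/\ forall j, a j = 0 -> del j = 0, \sum_j del j *: W j = 0
      & exists j, del j != 0].
  pose M := \matrix_(i < #|A|) W (enum_val i).
  have : kermx M != 0.
    rewrite -mxrank_eq0 mxrank_ker -lt0n subn_gt0.
    by apply: leq_ltn_trans (rank_leq_col _) _; rewrite /A sE.
  case/rowV0Pn => v /sub_kermxP vM v0.
  have dE (V : lmodType R) (F : J -> V) :
     \sum_j (\sum_(i < #|A| | enum_val i == j) v 0 i) *: F j =
     \sum_(i < #|A|) v 0 i *: F (enum_val i).
    rewrite [RHS](partition_big (fun i => enum_val i) predT)//=.
    apply: eq_bigr => j _; rewrite scaler_suml.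
    by apply: eq_bigr => i /eqP ->.
  exists (fun j => \sum_(i < #|A| | enum_val i == j) v 0 i); split.
  - move=> j aj; rewrite big1// => i /eqP ij.
    by have := enum_valP i; rewrite ij inE aj eqxx.
  - rewrite dE; apply: etrans vM; apply/rowP => k; rewrite summxE [RHS]mxE.
    by apply: eq_bigr => i _; rewrite !mxE.
  - case/rV0Pn: v0 => i vi; exists (enum_val i).
    rewrite (bigD1 i)//= big1 ?addr0// => i' /andP[/eqP/enum_val_inj->].
    by rewrite eqxx.
(* Up to replacing [del] by its opposite, moving along it does not increase the sum against [b]. *)
wlog dbn : del delA delW dj0 / \sum_j del j * b j <= 0.
  move=> H; have [|dp] := leP (\sum_j del j * b j) 0; first exact: H.
  apply: (H (fun j => - del j)).
  - by move=> j /delA ->; rewrite oppr0.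
  - under eq_bigr do rewrite scaleNr.
    by rewrite sumrN delW oppr0.
  - by rewrite oppr_eq0.
  - under eq_bigr do rewrite mulNr.
    by rewrite sumrN oppr_le0 ltW.
(* Pairing [delW] with [w] gives a zero total, so the nonzero [del] has a negative entry. *)
have dsum : \sum_j del j = 0.
  transitivity (\sum_j \sum_k del j * W j 0 k * w 0 k).
    apply: eq_bigr => j _; rewrite -[LHS]mulr1 -(Ww j) mulr_sumr.
    by apply: eq_bigr => k _; rewrite mulrA.
  rewrite exchange_big big1//= => k _; rewrite -mulr_suml.
  move/rowP/(_ k): delW; rewrite summxE mxE.
  by under eq_bigr do rewrite mxE; move=> ->; rewrite mul0r.
have [j1 dj1] : exists j, del j < 0.
  apply: contrapT => /forallNP nd.
  have d0 j : 0 <= del j by rewrite leNgt; apply/negP/nd.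
  move/eqP: dsum; rewrite psumr_eq0// => /allP/(_ j0).
  by rewrite mem_index_enum => /(_ isT)/=; apply/negP.
(* Ratio test: the smallest step at which a decreasing weight vanishes keeps all weights
   nonnegative. *)
case: (@arg_minP _ _ _ j1 (fun j => del j < 0) (fun j => a j / - del j) dj1).
move=> j2 dj2 minj2.
pose t := a j2 / - del j2.
have t0 : 0 <= t by rewrite divr_ge0// oppr_ge0 ltW.
pose a1 j := a j + t * del j.
have a1j2 : a1 j2 = 0 by rewrite /a1 /t; field; rewrite lt_eqF.
have a10 j : 0 <= a1 j.
  rewrite /a1; have [dj|dj] := leP 0 (del j); first by rewrite addr_ge0// mulr_ge0.
  by have := minj2 j dj; rewrite -/t ler_pdivlMr ?oppr_gt0//; lra.
have aj2 : a j2 != 0.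
  by apply/eqP => /delA d2; rewrite d2 ltxx in dj2.
have supp1 j : a j = 0 -> a1 j = 0.
  by move=> aj; rewrite /a1 aj delA// mulr0 addr0.
have lt1 : (#|[set j | a1 j != 0%R]%SET| < s)%N.
  rewrite -sE; apply: proper_card; apply/properP; split.
    apply/fintype.subsetP => j; rewrite !inE; apply: contraNN => /eqP aj.
    by rewrite supp1.
  by exists j2; rewrite !inE ?a1j2 ?eqxx.
have [a' [a'0 a'supp a'W a'b a'c]] := IH _ lt1 a1 erefl a10.
exists a'; split=> //.
- by move=> j /supp1/a'supp.
- rewrite a'W /a1; under eq_bigr do rewrite scalerDl -scalerA.
  by rewrite big_split/= -scaler_sumr delW scaler0 addr0.
- apply: (le_trans a'b); rewrite /a1.
  under eq_bigr do rewrite mulrDl -mulrA.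
  by rewrite big_split/= -mulr_sumr gerDl mulr_ge0_le0.
Qed.

(** A positive [B] is refuted at a [t] where [t * B] exceeds [C - A]. Applied to one-parameter
    families of perturbations, this turns the subgradient inequality into the constraints on the
    multipliers. *)
Lemma bounded_slope_le0 (R : realFieldType) (A B C : R) :
  (forall t, 0 <= t -> A + t * B <= C) -> B <= 0.
Proof.
move=> H; rewrite leNgt; apply/negP => B0.
have := H ((`|C - A| + 1) / B); rewrite mulfVK ?gt_eqF//.
have t0 : 0 <= (`|C - A| + 1) / B by rewrite divr_ge0// ltW.
by move=> /(_ t0); have := ler_norm (C - A); lra.
Qed.

(** * Bilinearity of the inner product *)

Section dot_theory.
Context {R : realType} {n : nat}.
Implicit Types u v w : 'rV[R]_n.

Lemma dotDl u v w : dot (u + v) w = dot u w + dot v w.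
Proof.
by rewrite /dot -big_split; apply: eq_bigr => k _; rewrite mxE mulrDl.
Qed.

Lemma dotDr u v w : dot u (v + w) = dot u v + dot u w.
Proof.
by rewrite /dot -big_split; apply: eq_bigr => k _; rewrite mxE mulrDr.
Qed.

Lemma dotZl a u v : dot (a *: u) v = a * dot u v.
Proof. by rewrite /dot mulr_sumr; apply: eq_bigr => k _; rewrite mxE mulrA. Qed.

Lemma dotZr a u v : dot u (a *: v) = a * dot u v.
Proof. by rewrite /dot mulr_sumr; apply: eq_bigr => k _; rewrite mxE mulrCA. Qed.

Lemma dotNl u v : dot (- u) v = - dot u v.
Proof. by rewrite -scaleN1r dotZl mulN1r. Qed.

Lemma dotNr u v : dot u (- v) = - dot u v.
Proof. by rewrite -scaleN1r dotZr mulN1r. Qed.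

Lemma dot0l v : dot 0 v = 0.
Proof. by rewrite -(scale0r 0) dotZl mul0r. Qed.

Lemma dot_suml (I : Type) (s : seq I) (P : pred I) (F : I -> 'rV[R]_n) v :
  dot (\sum_(i <- s | P i) F i) v = \sum_(i <- s | P i) dot (F i) v.
Proof. by elim/big_rec2: _ => [|i y x _ <-]; rewrite ?dot0l ?dotDl. Qed.

Lemma dot_le0 u : dot u u <= 0 -> u = 0.
Proof.
move=> u0; have /eqP : dot u u = 0.
  by apply/eqP; rewrite eq_le u0 sumr_ge0// => k _; rewrite -expr2 sqr_ge0.
rewrite psumr_eq0 => [|k _]; last by rewrite -expr2 sqr_ge0.
move=> /allP uk; apply/rowP => k; rewrite mxE; apply/eqP.
by rewrite -(sqrf_eq0 (u 0 k)) expr2; apply: uk; rewrite mem_index_enum.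
Qed.

End dot_theory.

(** * Lagrange multipliers from a linear minorant of the value function *)

Section lagrange.
Context {R : realType} {n N : nat} {J : finType}.
Variables (blk : J -> 'I_N) (f : J -> 'rV[R]_n -> R) (cost : J -> R).
Variables (X : set 'rV[R]_n) (rho : R).

(* For fixed u, minimising over lam and mu is the linear program dual to
   maximising sum_j a_j f_j(u) over the weights a with unit mass on every block
   and total cost at most N * rho. *)
Definition lagrange_bound (v : R) : Prop :=
  forall (u : 'rV[R]_n) (lam : R) (mu : 'I_N -> R), X u -> 0 <= lam ->
    (forall j, f j u <= mu (blk j) + lam * cost j) ->
    N%:R * v <= \sum_i mu i + N%:R * rho * lam.

(** For fixed [u], [lam] and [mu] the condition is a non-strict upper bound on [v], so it survives
    the supremum. Attainment of the dual optimum rests on this. *)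
Lemma lagrange_bound_sup (A : set R) : (0 < N)%N -> A !=set0 ->
  (forall v, A v -> lagrange_bound v) -> lagrange_bound (sup A).
Proof.
move=> N0 A0 Ab u lam mu Xu lam0 feas; rewrite mulrC -ler_pdivlMr ?ltr0n//.
apply: ge_sup => // v /Ab/(_ u lam mu Xu lam0 feas).
by rewrite ler_pdivlMr ?ltr0n// mulrC.
Qed.

(** The linear minorant of the perturbed value function supplies both families: [a] pairs with the
    additive perturbations, [eta] with the shifts. In the last inequality each [f j] has its own
    argument, which is what produces conjugates. *)
Lemma lagrange_multipliers (v : R) :
  (forall j x y t, 0 < t < 1 ->
     f j (t *: x + (1 - t) *: y) <= t * f j x + (1 - t) * f j y) ->
  (forall x y t, X x -> X y -> 0 < t < 1 -> X (t *: x + (1 - t) *: y)) ->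
  X !=set0 -> lagrange_bound v ->
  exists (a : J -> R) (eta : J -> 'rV[R]_n),
  [/\ forall j, 0 <= a j, forall i, \sum_(j | blk j == i) a j = 1,
      \sum_j a j * cost j <= N%:R * rho,
      forall j, a j = 0 -> eta j = 0
    & forall (x : J -> 'rV[R]_n) u, X u ->
        N%:R * v <= \sum_j (a j * f j (x j) - dot (eta j) (x j))
                    + dot (\sum_j eta j) u].
Proof.
move=> fconv Xconv [u0 Xu0] bv.
pose pr (p : J + J * 'I_n -> R) j : 'rV[R]_n := \row_k p (inr (j, k)).
(* [p] collects the additive perturbations (left summand) and the shifts of the
   arguments (right summand); [G] is the epigraph of the value function. *)
pose G p r := exists (u : 'rV[R]_n) (lam : R) (mu : 'I_N -> R),
  [/\ X u, 0 <= lam,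
      forall j, f j (u + pr p j) + p (inl j) <= mu (blk j) + lam * cost j
    & \sum_i mu i + N%:R * rho * lam - N%:R * v <= r].
have [|||h hG] := @convex_minorant R _ G.
- move=> p r p' r' t [u [lam [mu [Xu lam0 fe re]]]].
  move=> [u' [lam' [mu' [Xu' lam'0 fe' re']]]] t01.
  have /andP[t0 t1] := t01.
  exists (t *: u + (1 - t) *: u'), (t * lam + (1 - t) * lam'),
    (fun i => t * mu i + (1 - t) * mu' i); split.
  + exact: Xconv.
  + by rewrite addr_ge0// mulr_ge0//; lra.
  + move=> j; set q := fun i => _.
    have -> : t *: u + (1 - t) *: u' + pr q j =
        t *: (u + pr p j) + (1 - t) *: (u' + pr p' j).
      by apply/rowP => k; rewrite /pr /q !mxE; ring.
    have := fconv j (u + pr p j) (u' + pr p' j) t t01.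
    rewrite /q; set A := f j (u + _); set B := f j (u' + _) => le1.
    have : 0 <= t * (mu (blk j) + lam * cost j - (A + p (inl j))).
      by rewrite mulr_ge0 ?subr_ge0 ?(ltW t0)//; exact: fe.
    have : 0 <= (1 - t) * (mu' (blk j) + lam' * cost j - (B + p' (inl j))).
      by rewrite mulr_ge0 ?subr_ge0 ?(ltW t1)//; exact: fe'.
    by move: le1; lra.
  + have : 0 <= t * (r - (\sum_i mu i + N%:R * rho * lam - N%:R * v)).
      by rewrite mulr_ge0 ?subr_ge0 ?(ltW t0).
    have : 0 <= (1 - t) * (r' - (\sum_i mu' i + N%:R * rho * lam' - N%:R * v)).
      by rewrite mulr_ge0 ?subr_ge0 ?(ltW t1).
    by rewrite big_split/= -!mulr_sumr; lra.
(* Every perturbation admits a feasible point: [u0], [lam = 0] and a large enough [mu]. *)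
- move=> p; exists (\sum_(i < N) \sum_j `|f j (u0 + pr p j) + p (inl j)|
    + N%:R * rho * 0 - N%:R * v).
  exists u0, 0, (fun i => \sum_j `|f j (u0 + pr p j) + p (inl j)|).
  split=> // j; rewrite mul0r addr0 (bigD1 j)//=.
  by rewrite (le_trans (ler_norm _))// lerDl sumr_ge0.
- move=> r [u [lam [mu [Xu lam0 fe re]]]]; apply: le_trans re.
  rewrite subr_ge0; apply: bv Xu lam0 _ => j; have := fe j.
  suff -> : u + pr (fun=> 0) j = u by rewrite addr0.
  by apply/rowP => k; rewrite !mxE addr0.
pose a j := h (inl j); pose eta j : 'rV[R]_n := \row_k h (inr (j, k)).
have key u lam mu (x : J -> 'rV[R]_n) (s : J -> R) : X u -> 0 <= lam ->
    (forall j, f j (x j) + s j <= mu (blk j) + lam * cost j) ->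
    \sum_j a j * s j + \sum_j dot (eta j) (x j - u)
      <= \sum_i mu i + N%:R * rho * lam - N%:R * v.
  move=> Xu lam0 fe.
  pose p (i : J + J * 'I_n) :=
    match i with inl j => s j | inr jk => (x jk.1 - u) 0 jk.2 end.
  have := hG p (\sum_i mu i + N%:R * rho * lam - N%:R * v).
  rewrite big_sumType/=.
  have -> : \sum_(i : J * 'I_n) h (inr i) * (x i.1 - u) 0 i.2 =
      \sum_j dot (eta j) (x j - u).
    rewrite pair_big_dep/=; apply: eq_bigr => -[j k] _ /=.
    by rewrite [eta j _ _]mxE.
  apply; exists u, lam, mu; split=> // j.
  suff -> : u + pr p j = x j by exact: fe.
  by apply/rowP => k; rewrite !mxE /p !mxE addrC subrK.
pose C := \sum_j a j * f j u0.
have key0 lam mu (s : J -> R) : 0 <= lam ->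
    (forall j, f j u0 + s j <= mu (blk j) + lam * cost j) ->
    \sum_j a j * s j <= \sum_i mu i + N%:R * rho * lam - N%:R * v.
  move=> lam0 fe; have := key u0 lam mu (fun=> u0) s Xu0 lam0 fe.
  rewrite [X in _ + X]big1 ?addr0// => j _.
  by rewrite subrr -(scale0r 0) dotZr mul0r.
have asplit (g : J -> R) : \sum_j a j * (g j - f j u0) = \sum_j a j * g j - C.
  by rewrite -sumrB; apply: eq_bigr => j _; rewrite mulrBr.
exists a, eta; split.
(* Lowering the perturbation of [f j] by any [t >= 0] keeps feasibility, so [a j] cannot be
   negative. *)
- move=> j; rewrite -oppr_le0.
  apply: (@bounded_slope_le0 _ (- C) _ (- (N%:R * v))) => t t0.
  have := key0 0 (fun=> 0) (fun j' => - (t * (j' == j)%:R) - f j' u0) (lexx _).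
  rewrite asplit [\sum_i 0]big1// mulr0 addr0 sub0r.
  have -> : \sum_j0 a j0 * - (t * (j0 == j)%:R) = t * - a j.
    rewrite (bigD1 j)//= eqxx mulr1 big1 ?addr0; first by ring.
    by move=> j' /negbTE ->; rewrite mulr0 oppr0 mulr0.
  rewrite addrC; apply => j'; rewrite addrC subrK mul0r addr0 oppr_le0.
  by rewrite mulr_ge0.
(* Moving [mu i] by [t] of either sign, together with the perturbations of block [i], forces unit
   mass. *)
- move=> i.
  have ki t : t * (\sum_(j | blk j == i) a j - 1) <= C - N%:R * v.
    have := key0 0 (fun i' => t * (i' == i)%:R)
      (fun j' => t * (blk j' == i)%:R - f j' u0) (lexx _).
    rewrite asplit mulr0 addr0.
    have -> : \sum_i0 t * (i0 == i)%:R = t.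
      rewrite (bigD1 i)//= eqxx big1 ?addr0 ?mulr1//.
      by move=> j' /negbTE ->; rewrite mulr0.
    have -> : \sum_j a j * (t * (blk j == i)%:R) = t * \sum_(j | blk j == i) a j.
      rewrite mulr_sumr [RHS]big_mkcond/=; apply: eq_bigr => j _.
      by case: (blk j == i); rewrite ?mulr1 ?mulr0// mulrC.
    have fe j : f j u0 + (t * (blk j == i)%:R - f j u0)
      <= t * (blk j == i)%:R + 0 * cost j by lra.
    by move=> /(_ fe); lra.
  apply/eqP; rewrite eq_le -[X in X && _]subr_le0 -[X in _ && X]subr_le0.
  apply/andP; split; apply: (@bounded_slope_le0 _ 0 _ (C - N%:R * v)) => t _.
    by rewrite add0r.
  by rewrite add0r; have := ki (- t); lra.
- rewrite -subr_le0.
  apply: (@bounded_slope_le0 _ (- C) _ (- (N%:R * v))) => t t0.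
  have := key0 t (fun=> 0) (fun j' => t * cost j' - f j' u0) t0.
  rewrite asplit [\sum_i 0]big1//.
  have -> : \sum_j a j * (t * cost j) = t * \sum_j a j * cost j.
    by rewrite mulr_sumr; apply: eq_bigr => j _; ring.
  have fe j : f j u0 + (t * cost j - f j u0) <= 0 + t * cost j by lra.
  by move=> /(_ fe); lra.
(* When [a j = 0] the value [f j (x j)] carries no weight, so [x j] may run off along [eta j]. *)
- move=> j aj; apply: dot_le0.
  apply: (@bounded_slope_le0 _ (- C) _ (- (N%:R * v))) => t t0.
  pose x j' := if j' == j then u0 + t *: eta j else u0.
  have := key u0 0 (fun=> 0) x (fun j' => - f j' (x j')) Xu0 (lexx _).
  have -> : \sum_j0 a j0 * - f j0 (x j0) = - C.
    rewrite -sumrN; apply: eq_bigr => j' _; rewrite mulrN /x.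
    by case: eqP => [->|//]; rewrite aj !mul0r.
  have -> : \sum_j0 dot (eta j0) (x j0 - u0) = t * dot (eta j) (eta j).
    rewrite (bigD1 j)//= big1 ?addr0 => [|j' /negbTE jj].
      by rewrite /x eqxx addrC addKr dotZr.
    by rewrite /x jj subrr -(scale0r 0) dotZr mul0r.
  rewrite [\sum_i 0]big1// !mulr0 add0r sub0r; apply => j'.
  by rewrite subrr mul0r addr0.
- move=> x u Xu.
  have := key u 0 (fun=> 0) x (fun j' => - f j' (x j')) Xu (lexx _).
  rewrite [\sum_i 0]big1// mulr0 addr0 sub0r.
  have fe j : f j (x j) - f j (x j) <= 0 + 0 * cost j by lra.
  have -> : \sum_j a j * - f j (x j) + \sum_j dot (eta j) (x j - u) =
      - (\sum_j (a j * f j (x j) - dot (eta j) (x j)) + dot (\sum_j eta j) u).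
    rewrite dot_suml -!big_split -sumrN; apply: eq_bigr => j _ /=.
    by rewrite dotDr dotNr; ring.
  by move=> /(_ fe); rewrite lerN2.
Qed.

End lagrange.

(** * The restricted dual program *)

(** The [x j] vary independently, so the suprema can be taken one index at a time. The point [t0]
    keeps every supremum above [-oo]; the remaining sum is then finite and can change sides. *)
Lemma lee_sum_ereal_sup (R : realType) (J : finType) (T : Type) (t0 : T)
    (g : J -> T -> R) (C : R) :
  (forall x : J -> T, \sum_j g j (x j) <= C) ->
  (\sum_j ereal_sup (range (fun t => (g j t)%:E)) <= C%:E)%E.
Proof.
have gtNy j : (-oo < ereal_sup (range (fun t => (g j t)%:E)))%E.
  by apply: (lt_le_trans (ltNyr (g j t0))); apply: ereal_sup_ubound; exists t0.
elim: (index_enum J) (index_enum_uniq J) C => [_ C H|a s IH /= /andP[nas us] C H].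
  by have := H (fun=> t0); rewrite !big_nil lee_fin.
rewrite big_cons; set sm := (\sum_(j <- s) _)%E.
have le_s t : (sm <= (C - g a t)%:E)%E.
  apply: IH => // x; have := H (fun j => if j == a then t else x j).
  rewrite big_cons eqxx addrC -lerBrDr; apply: le_trans; rewrite le_eqVlt.
  apply/orP; left; apply/eqP; apply: eq_big_seq => j js.
  by case: eqP => // ja; rewrite -ja js in nas.
have sfin : sm \is a fin_num.
  rewrite fin_numElt (le_lt_trans (le_s t0) (ltry _)) andbT.
  rewrite ltNye /sm; elim/big_ind : _ => //= [u v|j _]; last by rewrite -ltNye.
  by rewrite adde_eq_ninfty negb_or => -> ->.
rewrite -(fineK sfin) -leeBrDr//; apply: ge_ereal_sup => _ [t _ <-].
rewrite -EFinB lee_fin lerBrDr addrC -lerBrDr -lee_fin fineK//.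
Qed.

Section dual_program.
Context {R : realType} {n m N K : nat}.
Variables (X : set 'rV[R]_n).
Variables (c : 'rV[R]_m -> 'rV[R]_m -> R) (zhat : 'I_N -> 'rV[R]_m) (rho : R).
Variable l : 'I_K -> 'rV[R]_n -> 'rV[R]_m -> R.
Variable S : 'I_N -> {fset 'rV[R]_m}.
Hypothesis N_gt0 : (0 < N)%N.
Hypothesis X_neq0 : X !=set0.

Local Notation dvar := (@dual_var R n m N K).

(** Flattens the dependent triple sums of the program into sums over one finite type. *)
Definition atom_index := {i : 'I_N & (S i * 'I_K)%type}.
HB.instance Definition _ := Finite.on atom_index.

Definition blk (j : atom_index) : 'I_N := tag j.
Definition pt (j : atom_index) : 'rV[R]_m := val (tagged j).1.
Definition br (j : atom_index) : 'I_K := (tagged j).2.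
Definition piece (j : atom_index) (x : 'rV[R]_n) : R := l (br j) x (pt j).
Definition cost (j : atom_index) : R := c (pt j) (zhat (blk j)).

Lemma pt_in j : pt j \in S (blk j).
Proof. exact: valP. Qed.

Section reindex.
Context {V : Type} {idx : V} (op : Monoid.com_law idx).

Lemma big_atom_index (F : 'I_N -> 'rV[R]_m -> 'I_K -> V) (P : pred 'I_N) :
  \big[op/idx]_(i < N | P i) \big[op/idx]_(z <- S i) \big[op/idx]_(k < K) F i z k =
  \big[op/idx]_(j : atom_index | P (blk j)) F (blk j) (pt j) (br j).
Proof.
under eq_bigr => i _ do rewrite big_seq_fsetE pair_big.
by rewrite sig_big_dep /=; apply: eq_bigl => j; rewrite andbT.
Qed.

Lemma big_atom_block (F : 'I_N -> 'rV[R]_m -> 'I_K -> V) (i : 'I_N) :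
  \big[op/idx]_(z <- S i) \big[op/idx]_(k < K) F i z k =
  \big[op/idx]_(j : atom_index | blk j == i) F (blk j) (pt j) (br j).
Proof. by rewrite -(big_atom_index F (pred1 i)) big_pred1_eq. Qed.

End reindex.

(** Dual variables take every vector [z] as argument; [x0] is the value away from the atoms. *)
Definition atom_extend {V : Type} (x0 : V) (a : atom_index -> V) (i : 'I_N)
    (z : 'rV[R]_m) (k : 'I_K) : V :=
  if insub z is Some z' then
    a (Tagged (fun i => (S i * 'I_K)%type) ((z' : S i), k)) else x0.

Lemma atom_extendE {V : Type} (x0 : V) a j :
  atom_extend x0 a (blk j) (pt j) (br j) = a j.
Proof. by case: j => i [z k]; rewrite /atom_extend /pt /br/= valK. Qed.

Definition alpha (d : dvar) j : R := (dv_alpha d (blk j) (pt j) (br j))%:num.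
Definition slope (d : dvar) j : 'rV[R]_n := dv_y d (blk j) (pt j) (br j).

Lemma alpha_ge0 d j : 0 <= alpha d j.
Proof. by rewrite /alpha. Qed.

Lemma dual_feasibleE d : dual_feasible c zhat rho S d <->
  [/\ N%:R^-1 *: (\sum_j alpha d j *: slope d j) + (dv_nu d)%:num *: dv_theta d = 0,
      \sum_j alpha d j * cost j <= N%:R * rho
    & forall i, \sum_(j | blk j == i) alpha d j = 1].
Proof.
rewrite /dual_feasible !(big_atom_index _ _ predT) ler_pdivrMl ?ltr0n//.
have massE i := big_atom_block _ (fun i z k => (dv_alpha d i z k)%:num) i.
by split=> -[h1 h2 h3]; split=> // i; have := h3 i; rewrite massE.
Qed.

Lemma dual_objectiveE d : dual_objective X l S d =
  (- (N%:R^-1%:E * \sum_j (alpha d j)%:E * conj1 l (br j) (slope d j) (pt j))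
   - (dv_nu d)%:num%:E * support_fun X (dv_theta d))%E.
Proof. by rewrite /dual_objective (big_atom_index _ _ predT). Qed.

Lemma nb_nonzero_weightsE d :
  nb_nonzero_weights S d = #|[set j | alpha d j != 0%R]%SET|.
Proof.
rewrite /nb_nonzero_weights (big_atom_index _ _ predT) -sum1_card.
rewrite [RHS]big_mkcond; apply: eq_bigr => j _.
by rewrite inE /alpha; case: (_ != _).
Qed.

Lemma conj1_ge k w z u : ((dot w u - l k u z)%:E <= conj1 l k w z)%E.
Proof. by apply: ereal_sup_ubound; exists u. Qed.

Lemma sum_conj1_ge d u :
  ((\sum_j alpha d j * (dot (slope d j) u - piece j u))%:E
   <= \sum_j (alpha d j)%:E * conj1 l (br j) (slope d j) (pt j))%E.
Proof.
rewrite -sumEFin; apply: lee_sum => j _; rewrite EFinM.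
by apply: lee_wpmul2l; [rewrite lee_fin alpha_ge0 | exact: conj1_ge].
Qed.

(** All suprema are bounded below by their values at the same [u]; the balance constraint then
    cancels the linear terms. *)
Lemma weak_duality d u : dual_feasible c zhat rho S d -> X u ->
  (dual_objective X l S d <= (N%:R^-1 * \sum_j alpha d j * piece j u)%:E)%E.
Proof.
move=> /dual_feasibleE[balance _ _] Xu; rewrite dual_objectiveE.
have le1 : ((dv_nu d)%:num%:E * (dot (dv_theta d) u)%:E
    <= (dv_nu d)%:num%:E * support_fun X (dv_theta d))%E.
  by rewrite lee_wpmul2l ?lee_fin//; apply: ereal_sup_ubound; exists u.
have le2 := sum_conj1_ge d u.
have le3 : ((N%:R^-1)%:E * (\sum_j alpha d j * (dot (slope d j) u - piece j u))%:E
   <= (N%:R^-1)%:E *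
      \sum_j (alpha d j)%:E * conj1 l (br j) (slope d j) (pt j))%E.
  by rewrite lee_wpmul2l// lee_fin invr_ge0.
apply: (@le_trans _ _ (- ((N%:R^-1)%:E *
   (\sum_j alpha d j * (dot (slope d j) u - piece j u))%:E)
   - ((dv_nu d)%:num%:E * (dot (dv_theta d) u)%:E))%E).
  by apply: leeB => //; rewrite leeN2.
rewrite -!EFinM -EFinN -EFinB lee_fin.
have : dot (N%:R^-1 *: (\sum_j alpha d j *: slope d j)
   + (dv_nu d)%:num *: dv_theta d) u = 0 by rewrite balance dot0l.
rewrite dotDl !dotZl dot_suml.
have -> : \sum_j alpha d j * (dot (slope d j) u - piece j u) =
   \sum_j dot (alpha d j *: slope d j) u - \sum_j alpha d j * piece j u.
  by rewrite -sumrB; apply: eq_bigr => j _; rewrite dotZl mulrBr.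
by move=> e; rewrite mulrBr; lra.
Qed.

Local Notation bound := (lagrange_bound blk piece cost X rho).

(** Weak duality for the inner linear program: unit block masses handle [mu], the budget handles
    [lam]. *)
Lemma sum_alpha_le d lam (mu : 'I_N -> R) :
  dual_feasible c zhat rho S d -> 0 <= lam ->
  \sum_j alpha d j * (mu (blk j) + lam * cost j)
    <= \sum_i mu i + N%:R * rho * lam.
Proof.
move=> /dual_feasibleE[_ le2 mass] lam0.
have -> : \sum_j alpha d j * (mu (blk j) + lam * cost j) =
   \sum_i mu i + lam * \sum_j alpha d j * cost j.
  under eq_bigr do rewrite mulrDr.
  rewrite big_split/=; congr (_ + _); last first.
    by rewrite mulr_sumr; apply: eq_bigr => j _; rewrite mulrCA.
  rewrite (partition_big blk predT)//=; apply: eq_bigr => i _.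
  rewrite -[RHS]mul1r -(mass i) mulr_suml.
  by apply: eq_bigr => j /eqP ->.
by rewrite lerD2l mulrC ler_wpM2r.
Qed.

Lemma dual_bound d v : dual_feasible c zhat rho S d ->
  (v%:E <= dual_objective X l S d)%E -> bound v.
Proof.
move=> fd vd u lam mu Xu lam0 fe.
have := le_trans vd (weak_duality d u fd Xu).
rewrite lee_fin ler_pdivlMl ?ltr0n// => le1.
apply: (le_trans le1); apply: le_trans (sum_alpha_le _ _ mu fd lam0).
by apply: ler_sum => j _; rewrite ler_wpM2l ?alpha_ge0//; exact: fe.
Qed.

(** The multipliers give the weights [a], the slopes [eta / a], [nu = 1] and the [theta] that
    restores balance. Since [eta] vanishes wherever [a] does, inverting 0 is harmless. *)
Lemma strong_duality v :
  (forall k z, convex_function setT (fun x : 'rV[R]_n => l k x z)) ->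
  convex_set X -> bound v ->
  exists2 d : dvar, dual_feasible c zhat rho S d
    & (v%:E <= dual_objective X l S d)%E.
Proof.
move=> lconv Xconv bv.
have [||a [eta [a0 mass acost eta0 key]]] :=
    @lagrange_multipliers _ _ _ _ blk piece cost X rho v _ _ X_neq0 bv.
- move=> j x y t /andP[t0 t1].
  by have := lconv (br j) (pt j) (Itv01 (ltW t0) (ltW t1)) x y; rewrite !inE; apply.
- move=> x y t Xx Xy /andP[t0 t1].
  by have := Xconv x y (Itv01 (ltW t0) (ltW t1)); rewrite !inE; apply.
pose d : dvar := DualVar (atom_extend (NngNum (lexx (0 : R))) (fun j => NngNum (a0 j)))
  (atom_extend 0 (fun j => (a j)^-1 *: eta j))
  (- (N%:R^-1 *: \sum_j eta j)) (NngNum (@ler01 R)).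
have alphaE j : alpha d j = a j by rewrite /alpha /= atom_extendE.
have slopeE j : slope d j = (a j)^-1 *: eta j by rewrite /slope /= atom_extendE.
have aslope j : a j *: slope d j = eta j.
  rewrite slopeE; have [aj|aj] := eqVneq (a j) 0; last by rewrite scalerA divff// scale1r.
  by rewrite eta0// !scaler0.
exists d.
  apply/dual_feasibleE; split.
  - under eq_bigr do rewrite alphaE aslope.
    by rewrite scale1r subrr.
  - by under eq_bigr do rewrite alphaE.
  - by move=> i; under eq_bigr do rewrite alphaE; exact: mass.
rewrite dual_objectiveE mul1e.
set tot := (\sum_j _)%E.
(* Each weighted conjugate is at most the supremum of [dot (eta j) x - a j * piece j x], so the
   decoupled inequality bounds their sum. *)
have tot_le u : X u -> (tot <= (dot (\sum_j eta j) u - N%:R * v)%:E)%E.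
  move=> Xu; apply: (@le_trans _ _ (\sum_j ereal_sup
     (range (fun x => (dot (eta j) x - a j * piece j x)%:E)))%E).
    apply: lee_sum => j _; rewrite alphaE.
    have [aj|aj] := eqVneq (a j) 0.
      rewrite aj mul0e; apply: ereal_sup_ubound; exists 0 => //.
      by rewrite eta0// dot0l mul0r subrr.
    have aj0 : 0 < a j by rewrite lt_neqAle eq_sym aj a0.
    rewrite -lee_pdivlMl//; apply: ge_ereal_sup => _ [x _ <-].
    rewrite lee_pdivlMl//; apply: ereal_sup_ubound; exists x => //.
    by rewrite -EFinM -{1}aslope dotZl mulrBr.
  apply: (lee_sum_ereal_sup _ _ _ 0) => x; have := key x u Xu.
  have -> : \sum_j (a j * piece j (x j) - dot (eta j) (x j)) =
     - \sum_j (dot (eta j) (x j) - a j * piece j (x j)).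
    by rewrite -sumrN; apply: eq_bigr => j _; rewrite opprB.
  by lra.
have [u0 Xu0] := X_neq0.
have tfin : tot \is a fin_num.
  rewrite fin_numElt (le_lt_trans (tot_le _ Xu0) (ltry _)) andbT.
  exact: (lt_le_trans (ltNyr _) (sum_conj1_ge d 0)).
have sig_le : (support_fun X (dv_theta d) <= (- v - N%:R^-1 * fine tot)%:E)%E.
  apply: ge_ereal_sup => _ [u Xu <-]; have := tot_le u Xu.
  rewrite -{1}(fineK tfin) !lee_fin /= dotNl dotZl => le1.
  have : N%:R^-1 * fine tot <= N%:R^-1 * (dot (\sum_j eta j) u - N%:R * v).
    by rewrite ler_wpM2l ?invr_ge0.
  by rewrite mulrBr mulKf ?pnatr_eq0 -?lt0n//; lra.
rewrite -(fineK tfin) -EFinM.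
apply: (@le_trans _ _ (- (N%:R^-1 * fine tot)%:E - (- v - N%:R^-1 * fine tot)%:E)%E).
  by rewrite -EFinN -EFinB lee_fin; lra.
exact: leeB.
Qed.

(** With the slopes fixed, [W j] records block, slope and cost, so equal combinations preserve all
    [N + n + 1] linear constraints; [w] sums the block indicator, which gives 1. *)
Lemma dual_sparsify d : dual_feasible c zhat rho S d ->
  exists d' : dvar, [/\ dual_feasible c zhat rho S d',
    (dual_objective X l S d <= dual_objective X l S d')%E
    & (nb_nonzero_weights S d' <= N + n + 1)%N].
Proof.
move=> /dual_feasibleE[balance cst mass].
pose W j : 'rV[R]_(N + n + 1) :=
  row_mx (row_mx (delta_mx 0 (blk j)) (slope d j)) (const_mx (cost j)).
pose w : 'rV[R]_(N + n + 1) := row_mx (row_mx (const_mx 1) 0) 0.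
(* An infinite conjugate becomes 0 here; when the total is finite, it has zero weight both before
   and after. *)
pose b j := fine (conj1 l (br j) (slope d j) (pt j)).
have [|a [a0 asupp aW ab acard]] :=
    @sparse_conic_combination _ _ _ W w b (alpha d) _ (alpha_ge0 d).
  move=> j; rewrite !big_split_ord/= big_ord1 /W /w !row_mxEr !mxE mulr0 addr0.
  rewrite [X in _ + X]big1 ?addr0 => [|k _]; last first.
    by rewrite !row_mxEl !row_mxEr !mxE mulr0.
  rewrite (bigD1 (blk j))//= !row_mxEl !mxE !eqxx mulr1 big1 ?addr0// => i ij.
  by rewrite !row_mxEl !mxE (negbTE ij) andbF mul0r.
have aWk k : \sum_j a j * W j 0 k = \sum_j alpha d j * W j 0 k.
  move/rowP/(_ k): aW; rewrite !summxE.
  by under eq_bigr do rewrite mxE; under [RHS]eq_bigr do rewrite mxE.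
pose d' : dvar := DualVar (atom_extend (NngNum (lexx (0 : R))) (fun j => NngNum (a0 j)))
  (dv_y d) (dv_theta d) (dv_nu d).
have alphaE j : alpha d' j = a j by rewrite /alpha /= atom_extendE.
have slopeE : slope d' = slope d by [].
exists d'; split.
- apply/dual_feasibleE; split.
  + rewrite slopeE -[RHS]balance; congr (_ *: _ + _).
    apply/rowP => k; rewrite !summxE.
    have := aWk (lshift 1 (rshift N k)).
    under eq_bigr do rewrite /W row_mxEl row_mxEr.
    under [X in _ = X -> _]eq_bigr do rewrite /W row_mxEl row_mxEr.
    move=> e; under eq_bigr do rewrite mxE alphaE.
    by under [RHS]eq_bigr do rewrite mxE.
  + apply: le_trans cst; rewrite le_eqVlt; apply/orP; left; apply/eqP.
    have := aWk (rshift (N + n) ord0).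
    under eq_bigr do rewrite /W row_mxEr mxE.
    under [X in _ = X -> _]eq_bigr do rewrite /W row_mxEr mxE.
    by under [X in _ -> X = _]eq_bigr do rewrite alphaE.
  + move=> i; rewrite -(mass i); have := aWk (lshift 1 (lshift n i)).
    under eq_bigr do rewrite /W !row_mxEl mxE.
    under [X in _ = X -> _]eq_bigr do rewrite /W !row_mxEl mxE.
    have E (q : atom_index -> R) :
        \sum_(j | blk j == i) q j = \sum_j q j * ((0 == 0 :> 'I_1) && (i == blk j))%:R.
      rewrite big_mkcond; apply: eq_bigr => j _; rewrite eqxx eq_sym.
      by case: (_ == _); rewrite ?mulr1 ?mulr0.
    by rewrite !E; under [X in _ -> X = _]eq_bigr do rewrite alphaE.
- rewrite !dual_objectiveE slopeE; apply: leeB => //; rewrite leeN2.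
  rewrite lee_wpmul2l ?lee_fin ?invr_ge0//.
  set tot := (X in (_ <= X)%E); have [->|tny] := eqVneq tot +oo%E; first exact: leey.
  have tfin : tot \is a fin_num.
    rewrite fin_numElt; apply/andP; split; last by rewrite ltey.
    exact: (lt_le_trans (ltNyr _) (sum_conj1_ge d 0)).
  have term j : alpha d j != 0 -> conj1 l (br j) (slope d j) (pt j) \is a fin_num.
    move=> aj; have aj0 : 0 < alpha d j by rewrite lt_neqAle eq_sym aj alpha_ge0.
    move/sum_fin_numP : tfin => /(_ j (mem_index_enum _) isT).
    rewrite fin_numElt [in X in _ -> X]fin_numElt => /andP[_ lty].
    rewrite (lt_le_trans (ltNyr _) (conj1_ge _ _ _ 0))/=.
    rewrite ltey; apply/eqP => e; move: lty; rewrite e.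
    by rewrite gt0_muley ?lte_fin// ltxx.
  have termE q : (forall j, alpha d j = 0 -> q j = 0) ->
     (\sum_j (q j)%:E * conj1 l (br j) (slope d j) (pt j) = (\sum_j q j * b j)%:E)%E.
    move=> q0; rewrite -sumEFin; apply: eq_bigr => j _.
    have [aj|aj] := eqVneq (alpha d j) 0; first by rewrite q0// !mul0r mul0e.
    by rewrite EFinM /b fineK// term.
  rewrite /tot (termE (alpha d))//; under eq_bigr do rewrite alphaE.
  by rewrite (termE a)// lee_fin.
- rewrite nb_nonzero_weightsE; apply: leq_trans acard.
  by apply: subset_leq_card; apply/fintype.subsetP => j; rewrite !inE alphaE.
Qed.

End dual_program.

(** * Finitely supported measures *)

Definition atomic {d : measure_display} {T : measurableType d} {R : realType}
    {J : Type} (mu : {measure set T -> \bar R}) (s : seq J) (a : J -> R)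
    (z : J -> T) : Prop :=
  forall A, measurable A -> (mu A = \sum_(j <- s) (a j)%:E * \d_(z j) A)%E.

(** An explicit sum of scaled Dirac measures, with computable integrals; it also serves as the
    transport plan. *)
Lemma atomic_exists (d : measure_display) (T : measurableType d) (R : realType)
    (J : Type) (s : seq J) (a : J -> R) (z : J -> T) :
  (forall j, 0 <= a j) ->
  exists2 mu : {measure set T -> \bar R}, atomic mu s a z &
    forall f : T -> \bar R, measurable_fun setT f -> (forall x, 0 <= f x)%E ->
      (\int[mu]_x f x = \sum_(j <- s) (a j)%:E * f (z j))%E.
Proof.
move=> a0; elim: s => [|j s [mu muE muI]].
  exists mzero => [A mA|f mf f0]; rewrite big_nil//.
  exact: integral_measure_zero.
pose nu : {measure set T -> \bar R} :=
  measure_add (mscale (NngNum (a0 j)) (\d_(z j))) mu.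
exists nu => [A mA|f mf f0]; rewrite big_cons.
  by rewrite -muE//; exact: measure_addE.
rewrite ge0_integral_measure_add// muI// ge0_integral_mscale// integral_dirac//.
by rewrite diracT mul1e.
Qed.

Section integral_atomic.
Import HBNNSimple.

(* The integral is the supremum over the simple functions below [f], and the
   restriction of an arbitrary [f] to the atoms is measurable. *)
Lemma ge0_integral_atomic (d : measure_display) (T : measurableType d)
    (R : realType) (J : Type) (mu : {measure set T -> \bar R}) (s : seq J)
    (a : J -> R) (z : J -> T) (f : T -> \bar R) :
  (forall x : T, measurable [set x]) -> (forall j, 0 <= a j) ->
  atomic mu s a z -> (forall x, 0 <= f x)%E ->
  (\int[mu]_x f x = \sum_(j <- s) (a j)%:E * f (z j))%E.
Proof.
move=> m1 a0 muE f0; have [nu nuE nuI] := atomic_exists _ _ _ _ s a z a0.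
rewrite (@eq_measure_integral _ _ _ _ nu); last first.
  by move=> A mA _; rewrite muE// nuE.
apply/eqP; rewrite eq_le; apply/andP; split.
  rewrite ge0_integralTE//; apply: ge_ereal_sup => _ [h /= hf <-].
  rewrite -integralT_nnsfun nuI; last 2 first.
  - by apply/measurable_EFinP; exact: measurable_funPT.
  - by move=> x; rewrite lee_fin.
  by apply: lee_sum => j _; rewrite lee_wpmul2l// lee_fin.
pose F := \big[setU/set0]_(j <- s) [set z j].
have Ffin : finite_set F.
  by rewrite /F; elim/big_ind: _ => // A B ? ?; rewrite finite_setU.
have mfin B : B `<=` F -> measurable B.
  move=> BF.
  have -> : B = \bigcup_(x in B) [set x].
    by apply/seteqP; split => [x Bx|x [y By ->]//]; exists x.
  by apply: fin_bigcup_measurable; first exact: (sub_finite_set BF Ffin).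
have mf : measurable_fun setT (f \_ F).
  apply/(measurable_restrictT _ (mfin _ (@subset_refl _ F : F `<=` F))) => _ Y mY.
  by apply: mfin; exact: subIsetl.
have fF0 x : (0 <= (f \_ F) x)%E by rewrite patchE; case: ifP.
have -> : (\sum_(j <- s) (a j)%:E * f (z j) =
           \sum_(j <- s) (a j)%:E * (f \_ F) (z j))%E.
  have : \big[setU/set0]_(j <- s) [set z j] `<=` F by exact: subset_refl.
  elim: (s) => [|j s' IH]; first by move=> _; rewrite !big_nil.
  rewrite big_cons => sF; rewrite !big_cons IH => [|x ?]; last by apply: sF; right.
  by rewrite patchE mem_set//; apply: sF; left.
rewrite -nuI// ge0_integralTE// [leRHS]ge0_integralTE//.
apply: le_ereal_sup => _ [h /= hf <-]; exists h => // x.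
by apply: (le_trans (hf x)); rewrite patchE; case: ifP.
Qed.

(** Positive and negative parts reduce to the nonnegative case; real values keep both integrals
    finite. *)
Lemma integral_atomic (d : measure_display) (T : measurableType d)
    (R : realType) (J : Type) (mu : {measure set T -> \bar R}) (s : seq J)
    (a : J -> R) (z : J -> T) (f : T -> R) :
  (forall x : T, measurable [set x]) -> (forall j, 0 <= a j) ->
  atomic mu s a z ->
  (\int[mu]_x (f x)%:E = (\sum_(j <- s) a j * f (z j))%:E)%E.
Proof.
move=> m1 a0 muE; rewrite integralE !(ge0_integral_atomic _ _ _ _ mu s a z)//.
under eq_bigr do rewrite funeposE -EFin_max -EFinM.
under [X in (_ - X)%E]eq_bigr do rewrite funenegE -EFinN -EFin_max -EFinM.
rewrite !sumEFin -EFinB -sumrB; congr EFin; apply: eq_bigr => j _.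
rewrite -mulrBr; congr (_ * _).
by rewrite /Order.max; case: ltP => ?; case: ltP => ?; lra.
Qed.

End integral_atomic.

Lemma measurable_rV1 (R : realType) (m : nat) (z : 'rV[R]_m) :
  measurable [set z].
Proof.
rewrite -[X in measurable X]setCK; apply: measurableC; apply: sub_sigma_algebra.
apply: closed_openC; apply: accessible_closed_set1.
apply: hausdorff_accessible; exact: norm_hausdorff.
Qed.

Lemma measurable_rV_prod1 (R : realType) (m : nat) (z : 'rV[R]_m * 'rV[R]_m) :
  measurable [set z].
Proof.
case: z => z z'; have -> : [set (z, z')] = [set z] `*` [set z'].
  by apply/seteqP; split => [_ ->//|[u v] [/= -> ->]].
by apply: measurableX; exact: measurable_rV1.
Qed.

Section measures_on_rV.
Context {R : realType} {m : nat}.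
Local Notation E := 'rV[R]_m.
Local Notation measureE := {measure set E -> \bar R}.

Lemma finite_rV_closed (F : set E) : finite_set F -> closed F.
Proof.
move: F; apply/accessible_finite_set_closed.
by apply: hausdorff_accessible; exact: norm_hausdorff.
Qed.

Lemma open_rV_measurable (U : set E) : open U -> measurable U.
Proof. by move=> oU; apply: sub_sigma_algebra. Qed.

Lemma closed_rV_measurable (F : set E) : closed F -> measurable F.
Proof.
move=> cF; rewrite -(setCK F); apply: measurableC.
by apply: open_rV_measurable; exact: closed_openC.
Qed.

Lemma summE (I : Type) (s : seq I) (mu : I -> measureE) A :
  summ s mu A = (\sum_(i <- s) mu i A)%E.
Proof.
rewrite /summ; elim: s => [|i s IH]; first by rewrite !big_nil.
by rewrite !big_cons -IH; exact: measure_addE.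
Qed.

Lemma meanmE (k : nat) (mu : 'I_k -> measureE) A :
  meanm mu A = ((k%:R^-1)%:E * \sum_(i < k) mu i A)%E.
Proof. by rewrite -summE. Qed.

Lemma measure_fset_atoms (Q : measureE) (s : {fset E}) A : measurable A ->
  Q (A `&` [set` s]) = (\sum_(z <- s) Q [set z] * \d_z A)%E.
Proof.
move=> mA.
suff H : forall t : seq E, uniq t ->
    measurable (A `&` [set` t]) /\
    Q (A `&` [set` t]) = (\sum_(z <- t) Q [set z] * \d_z A)%E.
  by have [] := H s (fset_uniq s).
elim=> [_|z t IH /= /andP[zt ut]].
  by rewrite big_nil set_nil setI0; split => //; exact: measure0.
have [mt Qt] := IH ut.
have mz : measurable (A `&` [set z]) by apply: measurableI => //; exact: measurable_rV1.
have -> : A `&` [set` z :: t] = (A `&` [set z]) `|` (A `&` [set` t]).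
  apply/seteqP; split=> x /=; rewrite inE.
    by move=> [Ax /orP[/eqP xz|xt]]; [left | right].
  by move=> [[Ax xz]|[Ax xt]]; split=> //; rewrite ?xz ?eqxx// xt orbT.
split; first exact: measurableU.
transitivity (Q (A `&` [set z]) + Q (A `&` [set` t]))%E.
  apply: measureU => //.
  by apply/seteqP; split=> // x [[_ ->] [_ /= xt]]; rewrite xt in zt.
rewrite big_cons Qt; congr (_ + _)%E; rewrite diracE.
have [Az|nAz] := pselect (A z).
  by rewrite mem_set// mule1; congr (Q _); apply/seteqP; split=> [x []//|x ->].
rewrite memNset// mule0 -(measure0 Q); congr (Q _).
by apply/seteqP; split=> // x [Ax xz]; rewrite xz in Ax.
Qed.

Lemma notin_supp (Q : measureE) z : ~ supp Q z -> Q [set z] = 0%E.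
Proof.
move=> /existsNP[U /not_implyP[oU /not_implyP[Uz /negP]]].
rewrite -leNgt => QU.
apply: (@subset_measure0 _ _ _ _ [set z] U).
- exact: measurable_rV1.
- exact: open_rV_measurable.
- by move=> _ ->.
- by apply/eqP; rewrite eq_le QU measure_ge0.
Qed.

Lemma supp_sub_finite (Q : measureE) (F : set E) :
  finite_set F -> Q (~` F) = 0%E -> supp Q `<=` F.
Proof.
move=> finF QF z Qz; apply: contrapT => nFz.
have := Qz (~` F) (closed_openC (finite_rV_closed _ finF)) nFz.
by rewrite QF ltxx.
Qed.

(** The finite carrier of [Q] and [s] may differ, so the mass is computed on their union; points
    outside [s] lie off the support and are null. *)
Lemma finite_prob_atomic (Z : set E) (Q : measureE) (s : {fset E}) :
  finite_prob_on Z Q -> supp Q `<=` [set` s] ->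
  atomic Q s (fun z => fine (Q [set z])) id.
Proof.
move=> [[QT _] [F [finF _ QF]]] sub A mA.
have Qfin z : Q [set z] \is a fin_num.
  rewrite ge0_fin_numE// (@le_lt_trans _ _ 1%E) ?ltry// -QT.
  by apply: le_measure; rewrite ?inE//; exact: measurable_rV1.
pose G := (fset_set F `|` s)%fset.
have mG : measurable [set` G].
  by apply: closed_rV_measurable; apply: finite_rV_closed; exact: finite_fset.
have -> : Q A = Q (A `&` [set` G]).
  rewrite -[in LHS](setIT A) -(setUv [set` G]) setIUr.
  transitivity (Q (A `&` [set` G]) + Q (A `&` ~` [set` G]))%E; last first.
    rewrite [X in (_ + X)%E](_ : _ = 0%E) ?adde0//.
    apply: (@subset_measure0 _ _ _ _ _ (~` F)) => //.
    + by apply: measurableI => //; exact: measurableC.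
    + by apply: measurableC; apply: closed_rV_measurable; exact: finite_rV_closed.
    + by move=> x [_ nG] Fx; apply: nG; rewrite /= inE in_fset_set// mem_set.
  apply: measureU.
  - exact: measurableI.
  - by apply: measurableI => //; exact: measurableC.
  - by rewrite setIACA setICr setI0.
rewrite measure_fset_atoms//; under [RHS]eq_bigr do rewrite fineK//.
apply/esym/big_fset_incl; first exact: fsubsetUr.
move=> z _ zs; rewrite notin_supp ?mul0e// => /sub.
by rewrite /= (negbTE zs).
Qed.

Lemma finite_prob_supp (Z : set E) (Q : measureE) :
  finite_prob_on Z Q -> finite_set (supp Q) /\ supp Q `<=` Z.
Proof.
move=> [_ [F [finF FZ QF]]]; have sF := supp_sub_finite _ _ finF QF.
by split; [exact: sub_finite_set finF | exact: subset_trans FZ].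
Qed.

End measures_on_rV.

Section loss_theory.
Context {R : realType} {n m K : nat}.
Variable l : 'I_K -> 'rV[R]_n -> 'rV[R]_m -> R.
Hypothesis K_gt0 : (0 < K)%N.

Lemma loss_fin_num x z : loss l x z \is a fin_num.
Proof.
rewrite fin_numElt; apply/andP; split.
  apply: (lt_le_trans (ltNyr (l (Ordinal K_gt0) x z))).
  exact: (le_bigmax _ (fun k => (l k x z)%:E)).
rewrite /loss; elim/big_ind : _ => // [u v u1 v1|k _]; last exact: ltry.
by rewrite gt_max u1 v1.
Qed.

Lemma le_fine_loss k x z : l k x z <= fine (loss l x z).
Proof.
rewrite -lee_fin fineK ?loss_fin_num//.
exact: (le_bigmax _ (fun k => (l k x z)%:E)).
Qed.

Lemma fine_loss_le x z b : (forall k, l k x z <= b) -> fine (loss l x z) <= b.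
Proof.
move=> lb; rewrite -lee_fin fineK ?loss_fin_num//.
by apply: bigmax_le => [|k _]; rewrite ?leNye// lee_fin.
Qed.

End loss_theory.

(** * The measure attached to a dual point *)

Section dual_measure_theory.
Context {R : realType} {n m N K : nat}.
Variables (X : set 'rV[R]_n) (Z : set 'rV[R]_m).
Variables (c : 'rV[R]_m -> 'rV[R]_m -> R) (zhat : 'I_N -> 'rV[R]_m) (rho : R).
Variable l : 'I_K -> 'rV[R]_n -> 'rV[R]_m -> R.
Variable S : 'I_N -> {fset 'rV[R]_m}.
Hypothesis N_gt0 : (0 < N)%N.

Local Notation J := (@atom_index R m N K S).
Local Notation dvar := (@dual_var R n m N K).
Implicit Type d : dvar.

Lemma weight_ge0 d (j : J) : 0 <= N%:R^-1 * alpha S d j.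
Proof. by rewrite mulr_ge0 ?invr_ge0 ?alpha_ge0. Qed.

Lemma dual_measure_atomic d :
  atomic (dual_measure S d) (index_enum J) (fun j => N%:R^-1 * alpha S d j)
    (fun j => pt S j).
Proof.
move=> A _; rewrite /dual_measure meanmE.
under eq_bigr => i _.
  rewrite summE; under eq_bigr do rewrite summE.
  over.
rewrite (big_atom_index S _ _ predT) ge0_sume_distrr//.
by apply: eq_bigr => j _; rewrite EFinM muleA.
Qed.

Lemma risk_dual_measure d u : (0 < K)%N ->
  risk l u (dual_measure S d) =
  (N%:R^-1 * \sum_j alpha S d j * fine (loss l u (pt S j)))%:E.
Proof.
move=> K0; rewrite /risk.
under eq_integral do rewrite -(fineK (loss_fin_num l K0 _ _)).
rewrite (integral_atomic _ _ _ _ _ _ _ _ (fun z => fine (loss l u z)) _ _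
  (dual_measure_atomic d)); last 2 first.
- exact: measurable_rV1.
- exact: weight_ge0.
by rewrite mulr_sumr; congr EFin; apply: eq_bigr => j _; rewrite mulrA.
Qed.

(** The plan moving mass [alpha / N] from each atom to its own sample is a coupling: unit block
    masses give the empirical marginal, and the budget bounds its cost. *)
Lemma dual_measure_ambiguity d : transport_cost Z c -> closed Z ->
  (forall i, Z (zhat i)) -> (forall i, [set` S i] `<=` Z) ->
  dual_feasible c zhat rho S d ->
  ambiguity Z c zhat rho (dual_measure S d).
Proof.
move=> [c0 _ _ _] cZ Zzhat SZ /(dual_feasibleE _ _ _ _ N_gt0)[_ acost mass].
have Zpt (j : J) : Z (pt S j) by apply: (SZ (blk S j)); exact: pt_in.
have tot : \sum_j alpha S d j = N%:R.
  rewrite (partition_big (blk S) predT)//=.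
  by rewrite (eq_bigr (fun=> 1)) ?sumr_const ?card_ord.
have full A : measurable A -> Z `<=` A -> dual_measure S d A = 1%E.
  move=> mA ZA; rewrite dual_measure_atomic//.
  under eq_bigr => j _ do rewrite diracE (mem_set (ZA _ (Zpt j))) mule1.
  rewrite sumEFin -mulr_sumr tot mulVf// pnatr_eq0 -lt0n//.
split.
  split; first by apply: full.
  by apply: full => //; exact: closed_rV_measurable.
have [gam gamE _] := atomic_exists _ _ R _ (index_enum J)
  (fun j => N%:R^-1 * alpha S d j) (fun j => (pt S j, zhat (blk S j)))
  (weight_ge0 d).
apply: (@le_trans _ _ (\int[gam]_(zz in Z `*` Z) (c zz.1 zz.2)%:E)%E).
  apply: ereal_inf_lbound; exists gam => // A mA; split.
    rewrite gamE; last exact: measurableX.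
    rewrite dual_measure_atomic//; apply: eq_bigr => j _; congr (_ * _)%E.
    by rewrite !diracE in_setX in_setT andbT.
  rewrite gamE; last exact: measurableX.
  rewrite meanmE ge0_sume_distrr//.
  rewrite (partition_big (blk S) predT)//=; apply: eq_bigr => i _.
  rewrite (eq_bigr (fun j => (N%:R^-1 * alpha S d j)%:E * \d_(zhat i) A)%E).
    rewrite -ge0_sume_distrl => [|j _]; last by rewrite lee_fin weight_ge0.
    by rewrite sumEFin -mulr_sumr mass mulr1.
  by move=> j /eqP <-; rewrite !diracE in_setX in_setT.
rewrite integral_mkcond.
rewrite (eq_integral (fun zz => (((fun zz => c zz.1 zz.2) \_ (Z `*` Z)) zz)%:E));
  last by move=> zz _; rewrite !patchE; case: ifP.
rewrite (integral_atomic _ _ _ _ _ _ _ _ _ _ _ gamE); last 2 first.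
- exact: measurable_rV_prod1.
- exact: weight_ge0.
rewrite lee_fin; under eq_bigr => j _.
  rewrite patchE mem_set/=; last by split.
  rewrite -mulrA.
  over.
by rewrite -mulr_sumr ler_pdivrMl ?ltr0n.
Qed.

(** The atoms of nonzero weight form a finite, hence closed, carrier; distinct triples may share an
    atom, so their number is only an upper bound. *)
Lemma supp_dual_measure_le d k : (nb_nonzero_weights S d <= k)%N ->
  (supp (dual_measure S d) #<= `I_k)%card.
Proof.
rewrite nb_nonzero_weightsE => nzk.
pose B := [set j : J | alpha S d j != 0%R]%SET.
pose F := [fset pt S j | j in B]%fset.
have sF : supp (dual_measure S d) `<=` [set` F].
  apply: supp_sub_finite; first exact: finite_fset.
  rewrite dual_measure_atomic; last first.
    apply: measurableC; apply: closed_rV_measurable; apply: finite_rV_closed.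
    exact: finite_fset.
  apply: big1 => j _; have [->|aj] := eqVneq (alpha S d j) 0.
    by rewrite mulr0 mul0e.
  rewrite diracE memNset ?mule0// => nF; apply: nF => /=.
  by apply/imfsetP; exists j => //=; rewrite inE.
apply: (card_le_trans (subset_card_le sF)).
have Fk : (#|` F| <= k)%N.
  apply: leq_trans nzk; apply: leq_trans (leq_imfset_card _ _ _) _.
  by rewrite cardE.
have : ([set` F] #= `I_(#|` F|))%card by apply/card_eq_fsetP.
rewrite card_eq_le => /andP[FI _]; apply: (card_le_trans FI).
by rewrite card_le_II.
Qed.

End dual_measure_theory.

(** * The averaged history as a dual point *)

Section history.
Context {R : realType} {n m N K T : nat}.
Variables (Z : set 'rV[R]_m).
Variables (c : 'rV[R]_m -> 'rV[R]_m -> R) (zhat : 'I_N -> 'rV[R]_m) (rho : R).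
Variable Q : 'I_T -> 'I_N -> {measure set 'rV[R]_m -> \bar R}.
Hypothesis T_gt0 : (0 < T)%N.
Hypothesis Q_atomic : forall t i, finite_prob_on Z (Q t i).

Lemma atomsE i :
  [set` atoms Q i] = \bigcup_(t in [set: 'I_T]) supp (Q t i).
Proof.
rewrite /atoms fset_setK//; apply: bigcup_finite => // t _.
by have [] := finite_prob_supp _ _ (Q_atomic t i).
Qed.

Lemma atoms_sub i : [set` atoms Q i] `<=` Z.
Proof.
rewrite atomsE => z [t _]; have [_] := finite_prob_supp _ _ (Q_atomic t i).
exact.
Qed.

Let w t i z : R := fine (Q t i [set z]).

Let w_ge0 t i z : 0 <= w t i z.
Proof. by rewrite fine_ge0. Qed.

Let Q_weights t i : atomic (Q t i) (atoms Q i) (w t i) id.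
Proof.
apply: finite_prob_atomic (Q_atomic t i) _.
by rewrite atomsE => z Qz; exists t.
Qed.

Let average i z : R := T%:R^-1 * \sum_(t < T) w t i z.

Let average_ge0 i z : 0 <= average i z.
Proof. by rewrite mulr_ge0 ?invr_ge0// sumr_ge0. Qed.

(* The averaged history is itself the measure of a feasible point: put the whole
   mass of every atom on the piece k0. *)
Let history (k0 : 'I_K) : @dual_var R n m N K :=
  DualVar (fun i z k => if k == k0 then NngNum (average_ge0 i z)
                        else NngNum (lexx (0 : R)))
    (fun _ _ _ => 0) 0 (NngNum (lexx (0 : R))).

Let sum_history k0 i (F : 'rV[R]_m -> R) :
  \sum_(z <- atoms Q i) \sum_(k < K) (dv_alpha (history k0) i z k)%:num * F z =
  T%:R^-1 * \sum_(t < T) \sum_(z <- atoms Q i) w t i z * F z.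
Proof.
rewrite [in RHS]exchange_big [RHS]mulr_sumr; apply: eq_bigr => z _.
rewrite (bigD1 k0)//= eqxx big1 ?addr0 => [|k /negbTE ->]; last by rewrite mul0r.
by rewrite /= /average -mulr_suml mulrA.
Qed.

(** Zero slopes and [nu = 0] satisfy the balance constraint; mass and budget hold in each round and
    survive averaging. *)
Lemma history_dual_var (k0 : 'I_K) :
  (forall t, (N%:R^-1%:E * \sum_(i < N) \int[Q t i]_(z in Z) (c z (zhat i))%:E
     <= rho%:E)%E) ->
  exists2 d : @dual_var R n m N K, dual_feasible c zhat rho (atoms Q) d &
    forall A, measurable A -> avg_measure Q A = dual_measure (atoms Q) d A.
Proof.
move=> Qcost; have T_neq0 : T%:R != 0 :> R by rewrite pnatr_eq0 -lt0n.
exists (history k0).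
  split=> /=.
  - rewrite scaler0 addr0 big1 ?scaler0// => i _.
    by rewrite big1// => z _; rewrite big1// => k _; rewrite scaler0.
  - under eq_bigr => i _ do rewrite (sum_history k0 i (fun z => c z (zhat i))).
    rewrite -mulr_sumr exchange_big/= mulrCA mulr_sumr ler_pdivrMl ?ltr0n//.
    have -> : T%:R * rho = \sum_(t < T) rho by rewrite sumr_const card_ord mulr_natl.
    apply: ler_sum => t _; rewrite -lee_fin; apply: le_trans (Qcost t).
    rewrite le_eqVlt; apply/orP; left; apply/eqP.
    rewrite EFinM -sumEFin; congr (_ * _)%E; apply: eq_bigr => i _.
    rewrite integral_mkcond.
    rewrite (eq_integral (fun z => (((fun z => c z (zhat i)) \_ Z) z)%:E));
      last by move=> z _; rewrite !patchE; case: ifP.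
    rewrite (integral_atomic _ _ _ _ _ _ _ _ _ _ _ (Q_weights t i))//; last first.
      exact: measurable_rV1.
    congr EFin; apply: eq_big_seq => z zi; rewrite patchE mem_set//.
    exact: (atoms_sub i).
  - move=> i; transitivity (\sum_(z <- atoms Q i) \sum_(k < K)
        (dv_alpha (history k0) i z k)%:num * 1).
      by apply: eq_bigr => z _; apply: eq_bigr => k _; rewrite mulr1.
    rewrite (sum_history k0 i (fun=> 1)); apply: (mulfI T_neq0); rewrite mulVKf// mulr1.
    rewrite (eq_bigr (fun=> 1)) ?sumr_const ?card_ord// => t _.
    have [[QT _] _] := Q_atomic t i; apply: EFin_inj; rewrite -QT.
    rewrite (Q_weights t i)// -sumEFin; apply: eq_bigr => z _.
    by rewrite diracT mule1 mulr1.
move=> A mA; rewrite /avg_measure /dual_measure !meanmE.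
transitivity ((T%:R^-1 * \sum_(t < T) (N%:R^-1 * \sum_(i < N)
    \sum_(z <- atoms Q i) w t i z * (z \in A)%:R))%:E).
  rewrite EFinM -sumEFin; congr (_ * _)%E; apply: eq_bigr => t _.
  rewrite meanmE EFinM -sumEFin; congr (_ * _)%E; apply: eq_bigr => i _.
  by rewrite (Q_weights t i)// -sumEFin; apply: eq_bigr => z _; rewrite diracE.
transitivity ((N%:R^-1 * \sum_(i < N) \sum_(z <- atoms Q i) \sum_(k < K)
    (dv_alpha (history k0) i z k)%:num * (z \in A)%:R)%:E).
  congr EFin; under [in RHS]eq_bigr => i _ do
    rewrite (sum_history k0 i (fun z => (z \in A)%:R)).
  by rewrite -!mulr_sumr exchange_big/= mulrCA.
rewrite EFinM -sumEFin; congr (_ * _)%E; apply: eq_bigr => i _.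
rewrite summE -sumEFin; apply: eq_bigr => z _.
by rewrite summE -sumEFin; apply: eq_bigr => k _.
Qed.

End history.

(** * Gap comparison, attainment and sparsity *)

Theorem theorem5 (R : realType) (n m N K T : nat)
    (X : set 'rV[R]_n) (Z : set 'rV[R]_m)
    (c : 'rV[R]_m -> 'rV[R]_m -> R) (zhat : 'I_N -> 'rV[R]_m) (rho : R)
    (l : 'I_K -> 'rV[R]_n -> 'rV[R]_m -> R)
    (alg : nat -> 'rV[R]_n -> ('rV[R]_n -> \bar R) -> 'rV[R]_n)
    (eps : 'I_T -> R) (x : nat -> 'rV[R]_n)
    (Q : 'I_T -> 'I_N -> {measure set 'rV[R]_m -> \bar R})
    (hN : (0 < N)%N) (hT : (0 < T)%N)
    (hc : transport_cost Z c)
    (hzhat : forall i, Z (zhat i))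
    (hrho : 0 < rho)
    (hreg : regularity X Z c zhat rho l)
    (hrun : dbr_run X Z c zhat rho l alg eps x Q) :
  let xbar := avg_decision T x in
  let Qbar := avg_measure Q in
  let S := atoms Q in
  (forall d : @dual_var R n m N K,
     dual_optimal X c zhat rho l S d ->
     ambiguity Z c zhat rho (dual_measure S d) /\
     (gap X Z c zhat rho l xbar (dual_measure S d)
      <= gap X Z c zhat rho l xbar Qbar)%E) /\
  (exists d : @dual_var R n m N K,
     [/\ dual_optimal X c zhat rho l S d,
         (nb_nonzero_weights S d <= N + n + 1)%N
       & (supp (dual_measure S d) #<= `I_(N + n + 1))%card]).
Proof.
move=> xbar Qbar S.
have [[X0 Xconv _ [_ cZ _]] [K2 lconv _] _] := hreg.
have K0 : (0 < K)%N := ltnW K2.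
have SZ i : [set` S i] `<=` Z := atoms_sub _ _ (dbr_atomic hrun) i.
have [d0 fd0 Qbar0] := @history_dual_var R n m N K T Z c zhat rho Q hT (dbr_atomic hrun)
  (Ordinal K0) (dbr_cost hrun).
pose bound := lagrange_bound (blk S) (piece l S) (cost c zhat S) X rho.
have strong v : bound v -> _ := strong_duality X c zhat rho l S hN X0 v lconv Xconv.
split.
  move=> d [fd opt]; split; first exact: dual_measure_ambiguity.
  (* The supremum in the gap depends only on [xbar]; it remains to compare the infima over [X]. *)
  apply: leeB => //; apply: le_ereal_inf_tmp => _ [u Xu <-].
  have riskQ y : risk l y Qbar = risk l y (dual_measure S d0).
    by apply: eq_measure_integral => A mA _; exact: Qbar0.
  set I := ereal_inf _.
  have Ile y : X y -> (I <= risk l y (dual_measure S d0))%E.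
    by move=> Xy; apply: ereal_inf_lbound; exists y.
  case E : I => [v| |]; last exact: leNye; last first.
    by have := Ile u Xu; rewrite E (risk_dual_measure _ _ _ _ K0).
  (* The infimum is a Lagrange bound: the historical weights are feasible, and since the cost does
     not depend on the piece, [fe] bounds the maximum of the pieces at each atom. *)
  have /strong[d1 fd1 vd1] : bound v.
    move=> y lam mu Xy lam0 fe.
    have := Ile y Xy; rewrite E (risk_dual_measure _ _ _ _ K0) lee_fin.
    rewrite ler_pdivlMl ?ltr0n// => le1.
    apply: (le_trans le1); apply: le_trans (sum_alpha_le _ _ _ _ hN _ _ mu fd0 lam0).
    apply: ler_sum => j _; rewrite ler_wpM2l ?alpha_ge0//.
    apply: (fine_loss_le _ K0) => k.
    exact: (fe (Tagged (fun i => (S i * 'I_K)%type) ((tagged j).1, k))).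
  (* Optimality gives a dual value of at least [v]; weak duality and domination of the pieces by the
     loss carry it to the risk at [u]. *)
  apply: (le_trans (le_trans vd1 (opt _ fd1))).
  apply: (le_trans (weak_duality _ _ _ _ _ _ hN _ _ fd Xu)).
  rewrite (risk_dual_measure _ _ _ _ K0) lee_fin ler_wpM2l ?invr_ge0//.
  apply: ler_sum => j _; rewrite ler_wpM2l ?alpha_ge0//.
  exact: le_fine_loss.
have [u0 Xu0] := X0.
pose A := [set v | exists2 d, dual_feasible c zhat rho S d
  & (v%:E <= dual_objective X l S d)%E].
have Abound v : A v -> bound v.
  by case=> d fd; exact: (dual_bound _ _ _ _ _ _ hN _ _ fd).
have Aobj d (b : \bar R) : dual_feasible c zhat rho S d ->
    (forall v, A v -> (v%:E <= b)%E) -> (dual_objective X l S d <= b)%E.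
  move=> fd Ab; case E : (dual_objective X l S d) => [v| |]; last exact: leNye.
    by apply: Ab; exists d => //; rewrite E.
  by have := weak_duality X _ _ _ l _ hN _ _ fd Xu0; rewrite E.
have [d [fd opt]] : exists d, dual_optimal X c zhat rho l S d.
  (* With [A] empty every feasible objective is [-oo], so the historical point is optimal. *)
  have [A0|nA0] := pselect (A !=set0); last first.
    exists d0; split=> // d fd; apply: Aobj => // v Av.
    by case: nA0; exists v.
  (* [sup A] is again a Lagrange bound, and strong duality yields a feasible point reaching it. *)
  have [d fd vd] := strong _ (lagrange_bound_sup _ _ _ _ _ _ hN A0 Abound).
  exists d; split=> // d' fd'; apply: Aobj => // v Av; apply: le_trans vd.
  rewrite lee_fin; apply: ub_le_sup => //.
  (* [A] is bounded above: its Lagrange bounds are tested at [u0] with [lam = 0] and a constant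
     [mu]. *)
  exists (N%:R^-1 * \sum_(i < N) \sum_j `|piece l S j u0|) => v1 /Abound bv.
  rewrite ler_pdivlMl ?ltr0n//.
  have := bv u0 0 (fun=> \sum_j `|piece l S j u0|) Xu0 (lexx _).
  rewrite mulr0 addr0; apply => j; rewrite mul0r addr0 (bigD1 j)//=.
  by rewrite (le_trans (ler_norm _))// lerDl sumr_ge0.
have [d' [fd' dd' nz]] := dual_sparsify X c zhat rho l S hN d fd.
exists d'; split=> //; last exact: supp_dual_measure_le.
by split=> // d2 /opt; move/le_trans; exact.
Qed.
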